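(* Let $\lambda=\lim_{n\to\infty}\lambda_n$ be the cardinal defined by $\lambda_0=\omega_0$ and $\lambda_{n+1}=2^{\lambda_n}$ for $n\ge 0$. Let $K_\lambda$ be the one-point (Alexandroff) compactification of the topological sum of the spaces $[\lambda]^{\le n}$, $n\in\mathbb N$. Then, for every set $\Gamma$ (of any cardinality), the Banach space $C(K_\lambda)$ does not coarsely embed into $c_0(\Gamma)$ and does not uniformly embed into $c_0(\Gamma)$.
   Context: For a set $\Lambda$ and $n\in\mathbb N$, $[\Lambda]^{\le n}$ denotes the set of subsets of $\Lambda$ of cardinality at most $n$, endowed with the restriction of the product topology on $\{0,1\}^\Lambda$ (each subset being identified with its characteristic function). $C(K)$ is the Banach space of continuous functions on the compact space $K$ with the sup norm. For a set $\Gamma$, $c_0(\Gamma)$ is the Banach space of scalar functions $x$ on $\Gamma$ such that $\{\gamma:|x(\gamma)|>\varepsilon\}$ is finite for all $\varepsilon>0$, with the sup norm. For a map $f:M_1\to M_2$ between metric spaces $(M_1,d_1)$, $(M_2,d_2)$ and $t\ge 0$ put $w_f(t)=\sup\{d_2(f(x),f(y)): x,y\in M_1,\ d_1(x,y)\le t\}$ and $\rho_f(t)=\inf\{d_2(f(x),f(y)): x,y\in M_1,\ d_1(x,y)\ge t\}$. The map $f$ is a uniform embedding if $\lim_{t\to0}w_f(t)=0$ and $\rho_f(t)>0$ for every $t>0$. It is a coarse embedding if $w_f(t)<\infty$ for all $0<t<\infty$ and $\lim_{t\to\infty}\rho_f(t)=\infty$. The embeddings are not assumed linear. *)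

(* Defs.v *)
From HB Require Import structures.
From mathcomp Require Import all_boot all_order all_algebra.
From mathcomp Require Import all_classical all_reals all_analysis.
From mathcomp Require Import complex.

Set Implicit Arguments.
Unset Strict Implicit.
Unset Printing Implicit Defensive.

Import Order.TTheory GRing.Theory Num.Theory.
Import numFieldNormedType.Exports.

Local Open Scope classical_set_scope.
Local Open Scope card_scope.
Local Open Scope ring_scope.

(** Moduli of a map between metric spaces, with values in [-oo, +oo]: the
    infimum over no pair at all is +oo. *)
Section moduli.
Context {R : realType} {M1 M2 : metricType R}.
Implicit Type f : M1 -> M2.

Definition expansion_modulus f (t : R) : \bar R :=
  ereal_sup [set (mdist (f p.1) (f p.2))%:E | p in
    [set p : M1 * M1 | mdist p.1 p.2 <= t]].

Definition compression_modulus f (t : R) : \bar R :=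
  ereal_inf [set (mdist (f p.1) (f p.2))%:E | p in
    [set p : M1 * M1 | t <= mdist p.1 p.2]].

Definition uniform_embedding f : Prop :=
  expansion_modulus f t @[t --> 0^'+] --> 0%E /\
  forall t : R, 0 < t -> (0 < compression_modulus f t)%E.

Definition coarse_embedding f : Prop :=
  (forall t : R, 0 < t -> (expansion_modulus f t < +oo)%E) /\
  compression_modulus f t @[t --> +oo] --> +oo%E.

End moduli.

Definition uniformly_embeds {R : realType} (M1 M2 : metricType R) : Prop :=
  exists f : M1 -> M2, uniform_embedding f.

Definition coarsely_embeds {R : realType} (M1 M2 : metricType R) : Prop :=
  exists f : M1 -> M2, coarse_embedding f.

Section metric_of_norm.
Context {R : realType} {V : normedModType R}.
Implicit Types x y : V.

Lemma norm_dist_ge0 x y : 0 <= `|x - y|.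
Proof. exact: normr_ge0. Qed.

Lemma norm_dist_positivity x y : `|x - y| = 0 -> x = y.
Proof. by move/eqP; rewrite normr_eq0 subr_eq0 => /eqP. Qed.

Lemma ballE_norm_dist x (d : R) : ball x d = [set y | `|x - y| < d].
Proof. by rewrite -ball_normE. Qed.

End metric_of_norm.

HB.mixin Record isCompactSpace T & Topological T := {
  compact_setT : compact [set: T]
}.

#[short(type="compactSpaceType")]
HB.structure Definition CompactSpace := {T of Topological T & isCompactSpace T}.

HB.instance Definition _ (X : topologicalType) :=
  isCompactSpace.Build (one_point_compactification X)
    (@one_point_compactification_compact X).

(** C(K), with values in a real normed space V (the scalar field in use). *)
Section continuous_functions.
Context {R : realType} (K : compactSpaceType) (V : normedModType R).

Definition continuous_pred : {pred K -> V} := fun f => `[< continuous f >].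

Lemma continuous_submod_closed : submod_closed continuous_pred.
Proof.
split; first by apply/asboolP => x; exact: cst_continuous.
move=> a f g /asboolP cf /asboolP cg; apply/asboolP => x.
by apply: cvgD; [apply: cvgZl_tmp; exact: cf|exact: cg].
Qed.

HB.instance Definition _ :=
  GRing.isSubmodClosed.Build R (K -> V) continuous_pred
    continuous_submod_closed.

Record cspace := CSpace {
  cspace_val :> K -> V ;
  cspace_in : cspace_val \in continuous_pred }.

HB.instance Definition _ := [isSub for cspace_val].
HB.instance Definition _ := [Choice of cspace by <:].
HB.instance Definition _ := [SubChoice_isSubLmodule of cspace by <:].

Definition cspace_norm (f : cspace) : R := sup [set `|f x| | x in [set: K]].

Lemma cspace_continuous (f : cspace) : continuous f.
Proof. by have /asboolP := cspace_in f. Qed.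

Lemma cspace_has_ubound (f : cspace) :
  has_ubound [set `|f x| | x in [set: K]].
Proof.
have : compact ((fun x => `|f x|) @` [set: K]).
  apply: continuous_compact; last exact: compact_setT.
  apply: continuous_subspaceT => x.
  exact: (cvg_comp _ _ (@cspace_continuous f x) (@norm_continuous _ _ _)).
move=> /compact_bounded[M [_ /(_ (M + 1))]]; rewrite ltrDl ltr01 => /(_ isT) h.
by exists (M + 1) => _ [x _ <-]; rewrite -[leLHS]normr_id; apply: h; exists x.
Qed.

Lemma cspace_norm_ub (f : cspace) x : `|f x| <= cspace_norm f.
Proof. by apply: (ub_le_sup (cspace_has_ubound f)); exists x. Qed.

Lemma cspace_norm_ge0 (f : cspace) : 0 <= cspace_norm f.
Proof.
have [A0|/set0P/negP/negPn/eqP A0] :=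
    pselect ([set `|f x| | x in [set: K]] !=set0).
  by have [_ [x _ _]] := A0; rewrite (le_trans _ (cspace_norm_ub f x)).
by rewrite /cspace_norm A0 sup0.
Qed.

Lemma cspace_norm_le (f : cspace) (c : R) :
  0 <= c -> (forall x, `|f x| <= c) -> cspace_norm f <= c.
Proof.
move=> c0 fc; have [[_ [x _ _]]|] :=
    pselect ([set `|f x| | x in [set: K]] !=set0).
  by apply: ge_sup => [|_ [y _ <-]//]; exists `|f x|, x.
by move/set0P/negP/negPn/eqP; rewrite /cspace_norm => ->; rewrite sup0.
Qed.

Let norm_normD (f g : cspace) :
  cspace_norm (f + g) <= cspace_norm f + cspace_norm g.
Proof.
apply: cspace_norm_le => [|x]; first by rewrite addr_ge0 ?cspace_norm_ge0.
by rewrite (le_trans (ler_normD _ _))// lerD ?cspace_norm_ub.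
Qed.

Let norm_normZ_le (a : R) (f : cspace) :
  cspace_norm (a *: f) <= `|a| * cspace_norm f.
Proof.
apply: cspace_norm_le => [|x]; first by rewrite mulr_ge0 ?cspace_norm_ge0.
by rewrite normrZ ler_wpM2l ?cspace_norm_ub.
Qed.

Let norm_normZ (a : R) (f : cspace) :
  cspace_norm (a *: f) = `|a| * cspace_norm f.
Proof.
apply/eqP; rewrite eq_le norm_normZ_le /=.
have [->|a0] := eqVneq a 0; first by rewrite normr0 mul0r cspace_norm_ge0.
rewrite -ler_pdivlMl ?normr_gt0// -normfV (le_trans _ (norm_normZ_le _ _))//.
by rewrite scalerA mulVf// scale1r.
Qed.

Let norm_norm0_eq0 (f : cspace) : cspace_norm f = 0 -> f = 0.
Proof.
move=> f0; apply/val_inj/funext => x /=; apply/eqP.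
by rewrite -normr_le0 -f0 cspace_norm_ub.
Qed.

HB.instance Definition _ :=
  Lmodule_isNormed.Build R cspace norm_normD norm_normZ norm_norm0_eq0.

HB.instance Definition _ := PseudoMetric_isMetric.Build R cspace
  norm_dist_ge0 norm_dist_positivity ballE_norm_dist.

End continuous_functions.

(** c_0(Gamma), with values in a real normed space V (the scalar field in
    use). *)
Section c0.
Context {R : realType} (Gamma : Type) (V : normedModType R).

Definition c0_pred : {pred Gamma -> V} := fun x =>
  `[< forall e : R, 0 < e -> finite_set [set g | e < `|x g|] >].

Lemma c0_submod_closed : submod_closed c0_pred.
Proof.
split.
  apply/asboolP => e e0; apply: (sub_finite_set _ (finite_set0 _)) => g /=.
  by rewrite normr0 ltNge ltW.
move=> a x y /asboolP cx /asboolP cy; apply/asboolP => e e0.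
have a0 : 0 < `|a| + 1 by rewrite ltr_wpDl.
have h1 : 0 < e / 2 by rewrite divr_gt0.
have h2 : 0 < e / 2 / (`|a| + 1) by rewrite divr_gt0.
apply: (@sub_finite_set _ _ ([set g | e / 2 / (`|a| + 1) < `|x g|] `|`
  [set g | e / 2 < `|y g|])); last by rewrite finite_setU; split; auto.
move=> g /= eg; apply/orP; rewrite !ltNge -negb_and; apply/negP => /andP[xg yg].
move: eg; rewrite ltNge => /negP; apply.
rewrite (le_trans (ler_normD _ _))// [leRHS]splitr lerD// normrZ.
rewrite ler_pdivlMr// in xg; rewrite (le_trans _ xg)// mulrC ler_wpM2l//.
by rewrite lerDl.
Qed.

HB.instance Definition _ :=
  GRing.isSubmodClosed.Build R (Gamma -> V) c0_pred c0_submod_closed.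

Record c0 := C0 { c0_val :> Gamma -> V ; c0_in : c0_val \in c0_pred }.

HB.instance Definition _ := [isSub for c0_val].
HB.instance Definition _ := [Choice of c0 by <:].
HB.instance Definition _ := [SubChoice_isSubLmodule of c0 by <:].

Definition c0_norm (x : c0) : R := sup [set `|x g| | g in [set: Gamma]].

Lemma c0_finite (x : c0) (e : R) : 0 < e -> finite_set [set g | e < `|x g|].
Proof. by have /asboolP := c0_in x; exact. Qed.

Lemma c0_has_ubound (x : c0) : has_ubound [set `|x g| | g in [set: Gamma]].
Proof.
have /(finite_image (fun g => `|x g|)) := c0_finite x ltr01.
move=> /finite_seqP[s sE]; exists (1 + \sum_(r <- s) `|r|) => _ [g _ <-].
have s0 (t : seq R) : 0 <= \sum_(r <- t) `|r| by exact: sumr_ge0.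
have [x1|x1] := leP `|x g| 1; first by rewrite (le_trans x1)// lerDl.
have : `|x g| \in s.
  have : ((fun g => `|x g|) @` [set g | 1 < `|x g|]) `|x g| by exists g.
  by rewrite sE.
elim: s {sE} => // r s IH; rewrite inE big_cons => /predU1P[<-|/IH].
  by rewrite normr_id addrCA lerDl addr_ge0.
by move=> /le_trans; apply; rewrite lerD2l lerDr.
Qed.

Lemma c0_norm_ub (x : c0) g : `|x g| <= c0_norm x.
Proof. by apply: (ub_le_sup (c0_has_ubound x)); exists g. Qed.

Lemma c0_norm_ge0 (x : c0) : 0 <= c0_norm x.
Proof.
have [A0|/set0P/negP/negPn/eqP A0] :=
    pselect ([set `|x g| | g in [set: Gamma]] !=set0).
  by have [_ [g _ _]] := A0; rewrite (le_trans _ (c0_norm_ub x g)).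
by rewrite /c0_norm A0 sup0.
Qed.

Lemma c0_norm_le (x : c0) (c : R) :
  0 <= c -> (forall g, `|x g| <= c) -> c0_norm x <= c.
Proof.
move=> c0 xc; have [[_ [g _ _]]|] :=
    pselect ([set `|x g| | g in [set: Gamma]] !=set0).
  by apply: ge_sup => [|_ [h _ <-]//]; exists `|x g|, g.
by move/set0P/negP/negPn/eqP; rewrite /c0_norm => ->; rewrite sup0.
Qed.

Let norm_normD (x y : c0) : c0_norm (x + y) <= c0_norm x + c0_norm y.
Proof.
apply: c0_norm_le => [|g]; first by rewrite addr_ge0 ?c0_norm_ge0.
by rewrite (le_trans (ler_normD _ _))// lerD ?c0_norm_ub.
Qed.

Let norm_normZ_le (a : R) (x : c0) : c0_norm (a *: x) <= `|a| * c0_norm x.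
Proof.
apply: c0_norm_le => [|g]; first by rewrite mulr_ge0 ?c0_norm_ge0.
by rewrite normrZ ler_wpM2l ?c0_norm_ub.
Qed.

Let norm_normZ (a : R) (x : c0) : c0_norm (a *: x) = `|a| * c0_norm x.
Proof.
apply/eqP; rewrite eq_le norm_normZ_le /=.
have [->|a0] := eqVneq a 0; first by rewrite normr0 mul0r c0_norm_ge0.
rewrite -ler_pdivlMl ?normr_gt0// -normfV (le_trans _ (norm_normZ_le _ _))//.
by rewrite scalerA mulVf// scale1r.
Qed.

Let norm_norm0_eq0 (x : c0) : c0_norm x = 0 -> x = 0.
Proof.
move=> x0; apply/val_inj/funext => g /=; apply/eqP.
by rewrite -normr_le0 -x0 c0_norm_ub.
Qed.

HB.instance Definition _ :=
  Lmodule_isNormed.Build R c0 norm_normD norm_normZ norm_norm0_eq0.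

HB.instance Definition _ := PseudoMetric_isMetric.Build R c0
  norm_dist_ge0 norm_dist_positivity ballE_norm_dist.

End c0.

(** The complex numbers as a normed space over the reals. *)
Section complex_normed.
Context {R : realType}.

HB.instance Definition _ :=
  PseudoMetric.copy (Rcomplex R) (pseudoMetric_normed (Rcomplex R)).
HB.instance Definition _ := isPointed.Build (Rcomplex R) 0.
HB.instance Definition _ :=
  NormedZmod_PseudoMetric_eq.Build R (Rcomplex R) erefl.

Let Rcomplex_normrZ (a : R) (z : Rcomplex R) : `|a *: z| = `|a| * `|z|.
Proof.
case: z => x y; rewrite /Num.norm/= !exprMn -mulrDr sqrtrM ?sqr_ge0//.
by rewrite sqrtr_sqr.
Qed.

HB.instance Definition _ :=
  PseudoMetricNormedZmod_Lmodule_isNormedModule.Build R (Rcomplex R)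
    Rcomplex_normrZ.

End complex_normed.

Definition is_scalar_field (R : realType) (F : normedModType R) : Prop :=
  F = R^o :> normedModType R \/ F = Rcomplex R :> normedModType R.

(** [L]^{<= n}, as a subspace of the product {0,1}^L. *)
Definition subsets_le (L : Type) (n : nat) : set {ptws L -> bool} :=
  [set chi : {ptws L -> bool} | [set i | chi i = true] #<= `I_n].
Arguments subsets_le : clear implicits.

Definition sum_subsets_le (L : Type) : topologicalType :=
  {n : nat & set_type (subsets_le L n)}.

Definition KL (L : Type) : compactSpaceType :=
  one_point_compactification (sum_subsets_le L).

(** A type of cardinality [lambda_n], where [lambda_0] is countable infinity and
    [lambda_(n+1) = 2 ^ lambda_n]. *)
Fixpoint beth (n : nat) : Type := if n is m.+1 then set (beth m) else nat.

(** [L] has cardinality [lim_n lambda_n], the least cardinal that is at least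
    every [lambda_n]. *)
Definition has_card_beth_omega (L : Type) : Prop :=
  (forall n, [set: beth n] #<= [set: L]) /\
  (forall U : Type,
    (forall n, [set: beth n] #<= [set: U]) -> [set: L] #<= [set: U]).

(* Main.v *)
Require Import Defs.
From mathcomp Require Import all_boot all_order all_algebra.
From mathcomp Require Import all_classical all_reals all_analysis.
From mathcomp Require Import complex.

Set Implicit Arguments.
Unset Strict Implicit.
Unset Printing Implicit Defensive.

Import Order.TTheory GRing.Theory Num.Theory.
Import numFieldNormedType.Exports.

Local Open Scope classical_set_scope.
Local Open Scope ring_scope.

(** The graph [L]^n, in which two n-tuples are adjacent when they differ in one
    entry, lies in C(K_L): send s to the sum of the evaluations
    A |-> [s_i in A] on the summand [L]^{<= n}, and to 0 elsewhere. This is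
    continuous because that summand is compact, adjacent tuples have images at
    distance at most 1, and two disjoint tuples s and t have images at distance
    at least n, as the set A = s shows (lemmas [indicator_sum_lipschitz] and
    [indicator_sum_separated]).

    On the other hand, if f maps tuples to c_0(Gamma) and moves every pair of
    adjacent tuples by at most d, then some disjoint s and t have
    |f s - f t| <= 4d, whatever n is ([c0_concentration]). By induction on n,
    let the first entry range over a set B far larger than the set X over which
    the other entries range. Fix b0 in B, and let C be the set of coordinates at
    which some f (b0, x) exceeds d. Each f (b0, x) contributes finitely many
    coordinates, so C is no larger than X times nat, and the scalars are no more
    numerous than the sets of integers. By pigeonhole there are b <> b' such that
    f (b, .) and f (b', .) agree on C. Off C, every value of
    f (b, .) and f (b', .) is at most 2d. Hence
    |f (b, x) - f (b', y)| <= max (4d, |f (b, x) - f (b, y)|), and the induction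
    hypothesis for f (b, .) provides x and y. Each step uses up boundedly many
    exponentials, so a set of cardinality beth_omega serves all n at once.

    Composing the two, a map h on C(K_L) that moves points at distance c by at
    most d has points at distance at least n c with images at distance at most
    4d ([close_images]). With c = 1 and n tending to infinity, this contradicts
    coarse embeddability; with c = 1/n, uniform embeddability. *)

(** * Cardinals below beth_omega *)

Definition below_beth_omega (T : Type) : Prop :=
  exists m (f : T -> beth m), injective f.

Lemma singleton_inj T (a b : T) : [set a] = [set b] -> a = b.
Proof. by move=> ab; have : [set b] a by rewrite -ab. Qed.

Lemma beth_le m k : (m <= k)%N -> exists f : beth m -> beth k, injective f.
Proof.
move=> /subnK <-; elim: (k - m)%N => [|d [f fI]]; first by exists id.
by exists (fun b => [set f b]) => b b' /= bb'; apply: fI; exact: singleton_inj.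
Qed.

Lemma below_beth_omega_countable (T : countType) : below_beth_omega T.
Proof. by exists 0%N, pickle; exact: (pcan_inj pickleK). Qed.

Lemma image_set_inj T U (f : T -> U) :
  injective f -> injective (fun A : set T => f @` A).
Proof.
move=> fI A B AB.
by apply/funext => t; rewrite -(image_inj (A := A) fI) AB image_inj.
Qed.

Lemma below_beth_omega_set T : below_beth_omega T -> below_beth_omega (set T).
Proof.
by move=> [m [f fI]]; exists m.+1, (fun A => f @` A); exact: image_set_inj.
Qed.

(** Pairs in T are coded by elements of the double power set of T, so that a
    product costs two exponentials: harmless below beth_omega. *)
Definition kuratowski_pair T (p : T * T) : set (set T) :=
  [set [set p.1]; [set p.1; p.2]].

Lemma kuratowski_pair_inj T : injective (@kuratowski_pair T).
Proof.
move=> [a b] [c d] E.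
have inl X : kuratowski_pair (a, b) X -> kuratowski_pair (c, d) X by rewrite E.
have inr X : kuratowski_pair (c, d) X -> kuratowski_pair (a, b) X by rewrite E.
have ac : a = c.
  have [/= h|/= h] := inl [set a] (or_introl erefl); first exact: singleton_inj.
  by have : [set a] c by [rewrite h; left].
rewrite -{}ac in inl inr *; congr pair.
have [/= h|/= h] := inl [set a; b] (or_intror erefl).
  have ba : b = a by have : [set a] b by [rewrite -h; right].
  rewrite {}ba in inr *; have [/= h'|/= h'] := inr [set a; d] (or_intror erefl).
    by have : [set a] d by [rewrite -h'; right].
  by have : [set a; a] d by [rewrite -h'; right]; case.
have : [set a; d] b by rewrite -h; right.
move=> [/= ba|//]; rewrite ba in h *.
by have : [set a; a] d by [rewrite h; right]; case.
Qed.

Lemma below_beth_omega_prod T U :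
  below_beth_omega T -> below_beth_omega U -> below_beth_omega (T * U).
Proof.
move=> [m [f fI]] [k [g gI]]; exists (maxn m k).+2.
have [f' f'I] := beth_le (leq_maxl m k).
have [g' g'I] := beth_le (leq_maxr m k).
exists (fun p => kuratowski_pair (f' (f p.1), g' (g p.2))).
by move=> [a b] [c d] /kuratowski_pair_inj [/f'I/fI -> /g'I/gI ->].
Qed.

Lemma cantor_no_injection T (h : set T -> T) : ~ injective h.
Proof.
move=> hI; pose D := [set t | exists2 A, h A = t & ~ A t].
have nD : ~ D (h D) by move=> DhD; have [A /hI -> ] := DhD; apply.
by apply: (nD); exists D.
Qed.

(** Asking for an infinite fibre, and not only for two points in it, lets the
    two points be chosen outside any given finite set. If all fibres were
    finite, numbering each of them would inject [beth m] into [Y * nat]. *)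
Lemma beth_pigeonhole Y : below_beth_omega Y ->
  exists m, forall g : beth m -> Y, exists y, infinite_set (g @^-1` [set y]).
Proof.
move=> hY.
have [m [u uI]] := below_beth_omega_prod hY (below_beth_omega_countable nat).
exists m.+1 => g; apply: contrapT => nfib.
have /choice[idx idxI] y : exists i : beth m.+1 -> nat,
    {in g @^-1` [set y] &, injective i}.
  apply/countable_injP; apply: finite_set_countable; apply: contrapT => fy.
  by apply: nfib; exists y.
apply: (@cantor_no_injection _ (fun b => u (g b, idx (g b) b))) => b b' /uI[gb].
by rewrite gb; apply: idxI; rewrite inE.
Qed.

Lemma infinite_avoid (T : Type) (L : eqType) (j : T -> L) (A : set T)
    (s : seq L) : injective j -> infinite_set A ->
  exists2 a, A a & j a \notin s.
Proof.
move=> jI Ainf; apply: contrapT => h; apply: Ainf.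
apply: (@sub_finite_set _ _ (j @^-1` [set` s])).
  by move=> a Aa; apply: contrapT => /negP js; apply: h; exists a.
by apply: finite_preimage => [a b _ _ /jI//|]; exact: finite_seq.
Qed.

(** * The scalar field *)

Lemma rat_cut_inj (R : realType) :
  injective (fun x : R => [set q : rat | ratr q < x]).
Proof.
move=> x y /seteqP[xy yx]; apply: contrapT => /eqP; rewrite neq_lt => /orP[]h.
- have [q] := rat_in_itvoo h; rewrite in_itv/= => /andP[xq /yx/=].
  by rewrite ltNge (ltW xq).
- have [q] := rat_in_itvoo h; rewrite in_itv/= => /andP[yq /xy/=].
  by rewrite ltNge (ltW yq).
Qed.

(** Bounds the number of scalars for the pigeonhole argument: a real number is
    coded by its Dedekind cut, a complex number by two of them. *)
Lemma scalar_field_code (R : realType) (F : normedModType R) :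
  is_scalar_field F -> exists code : F -> set nat, injective code.
Proof.
have pI (T : countType) : injective (fun A : set T => pickle @` A).
  by apply: image_set_inj; exact: (pcan_inj pickleK).
case=> ->.
  by exists (fun x => pickle @` [set q : rat | ratr q < (x : R)]) => x y /pI
    /rat_cut_inj.
pose cut (z : Rcomplex R) := [set p : bool * rat |
  ratr p.2 < (if p.1 then complex.Re z else complex.Im z)].
exists (fun z => pickle @` cut z) => -[a b] [c d] /pI E.
have h t q : cut (a +i* b)%C (t, q) = cut (c +i* d)%C (t, q) by rewrite E.
congr (_ +i* _)%C; apply: rat_cut_inj; apply/funext => q.
- exact: (h true q).
- exact: (h false q).
Qed.

Lemma scalar_field_unit (R : realType) (F : normedModType R) :
  is_scalar_field F -> exists e : F, `|e| = 1.
Proof.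
case=> ->; first by exists (1 : R^o); rewrite normr1.
exists (1 : Rcomplex R).
by rewrite /Num.norm/= expr1n expr0n addr0 sqrtr1.
Qed.

(** * Concentration of maps from tuples to c_0 *)

(** The index type [X] and the enumeration [phi] of tuples are chosen before
    [Gamma] and [f]: in the inductive step the first entry has to range over a
    set that is large with respect to [X]. The finite set [E] holds the
    entries already chosen, so that the two tuples end up disjoint. *)
Lemma c0_concentration (R : realType) (V : normedModType R)
    (code : V -> set nat) (codeI : injective code) (L : choiceType)
    (hL : forall m, exists j : beth m -> L, injective j) (n : nat) :
  exists (X : Type) (phi : X -> seq L),
    [/\ below_beth_omega X, forall x, size (phi x) = n &
    forall (Gamma : Type) (f : seq L -> c0 Gamma V) (d : R) (E : seq L), 0 < d ->
      (forall u v a b, `|f (u ++ a :: v) - f (u ++ b :: v)| <= d) ->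
      exists x y, [/\ uniq (phi x ++ phi y),
        ~~ has (mem E) (phi x ++ phi y) &
        `|f (phi x) - f (phi y)| <= d *+ 4]].
Proof.
elim: n => [|n [X [phi [Xsmall phin IH]]]].
  exists unit, (fun=> [::]); split => //.
    exact: below_beth_omega_countable.
  move=> Gamma f d E d0 _; exists tt, tt.
  by rewrite subrr normr0 mulrn_wge0// ltW.
have hY : below_beth_omega (set (X * X * nat * nat)).
  by apply: below_beth_omega_set; do 2! [apply: below_beth_omega_prod;
    last exact: below_beth_omega_countable]; exact: below_beth_omega_prod.
have [m hm] := beth_pigeonhole hY; have [j jI] := hL m.
exists (beth m * X)%type, (fun p => j p.1 :: phi p.2); split.
- by apply: below_beth_omega_prod => //; exists m, id.
- by move=> [b x] /=; rewrite phin.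
move=> Gamma f d E d0 fL.
have [b0] : exists b : beth m, True.
  by case: (m) => [|k]; [exists 0%N|exists set0].
move=> _.
(* The union of the finite sets [S y] is the set C of coordinates on which the
   pigeonhole principle will make two values of the first entry agree. *)
pose S y := [set g | d < `|f (j b0 :: phi y) g|].
have /choice[idx idxI] y : exists i : Gamma -> nat, {in S y &, injective i}.
  by apply/countable_injP; apply: finite_set_countable; exact: c0_finite.
(* [G b] records the restriction of [f (j b :: phi x)] to C, for all x; a
   coordinate in C is named by some [y] and its number in [S y]. *)
pose G b : set (X * X * nat * nat) := [set p : X * X * nat * nat |
  let: (x, y, k, q) := p in
  exists g, [/\ S y g, idx y g = k & code (f (j b :: phi x) g) q]].
have [A Ainf] := hm G.
have [b Ab jb] := infinite_avoid E jI Ainf.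
have [b' Ab' jb'] := infinite_avoid (j b :: E) jI Ainf.
have agree x y g : S y g -> f (j b :: phi x) g = f (j b' :: phi x) g.
  move=> Sg; apply: codeI; apply/funext => q.
  have GG : G b = G b' by rewrite Ab Ab'.
  have key c c' : G c = G c' ->
      code (f (j c :: phi x) g) q -> code (f (j c' :: phi x) g) q.
    move=> cc h; have : G c (x, y, idx y g, q) by exists g.
    rewrite cc => -[g' [Sg' ig' h']].
    by rewrite -(idxI y g' g) // inE.
  by apply/propext; split; apply: key.
have [x [y [u nE xy]]] := IH Gamma (fun s => f (j b :: s)) d [:: j b, j b' & E]
  d0 (fun u v => fL (j b :: u) v).
exists (b, x), (b', y); split.
- move: jb'; rewrite inE negb_or => /andP[jbb' _].
  rewrite (_ : uniq _ = uniq [:: j b, j b' & phi x ++ phi y]); last first.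
    by apply: perm_uniq; rewrite /= perm_cons perm_catC /= perm_cons perm_catC.
  rewrite /= inE negb_or eq_sym jbb' u andbT /=.
  by apply/andP; split; apply: contra nE => h; apply/hasP;
    [exists (j b)|exists (j b')]; rewrite // !inE eqxx ?orbT.
- move: jb'; rewrite inE negb_or => /andP[_ jb'].
  rewrite /= has_cat /= !negb_or jb jb' /= -negb_or -has_cat.
  by apply: contra nE; apply: sub_has => z /=; rewrite !inE => ->; rewrite !orbT.
apply: c0_norm_le => [|g]; first by rewrite mulrn_wge0// ltW.
have subE (s t : c0 Gamma V) : (s - t) g = s g - t g by [].
(* On C the first entries [j b'] and [j b] give the same values; off C both
   values are within [d] of a value that is itself at most [d]. *)
have [[z Sz]|nS] := pselect (exists z, S z g).
  have -> : (f (j b :: phi x) - f (j b' :: phi y)) g =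
            (f (j b :: phi x) - f (j b :: phi y)) g.
    by rewrite !subE (agree y z g Sz).
  exact: le_trans (c0_norm_ub _ g) xy.
have small s z : `|f (j s :: phi z) g| <= d *+ 2.
  have hb0 : `|f (j b0 :: phi z) g| <= d.
    by rewrite leNgt; apply/negP => h; apply: nS; exists z.
  rewrite -[f (j s :: _) g](subrK (f (j b0 :: phi z) g)).
  rewrite (le_trans (ler_normD _ _))// mulr2n lerD//.
  apply: le_trans (c0_norm_ub (f (j s :: phi z) - f (j b0 :: phi z)) g) _.
  exact: (fL [::]).
by rewrite subE (le_trans (ler_normB _ _))// -[4%N]/(2 + 2)%N mulrnDr lerD.
Qed.

(** * Sums of indicators in C(K_L) *)

Lemma compact_set_type (X : topologicalType) (A : set X) :
  compact A -> compact [set: set_type A].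
Proof.
move=> Aco F FF _.
have GA : F (set_val @^-1` A) by apply: filterE => x; exact: (set_valP x).
have [x [Ax xG]] := Aco (set_val @ F) _ GA.
exists (exist _ x (mem_set Ax)); split => // U V FU.
rewrite nbhsE => -[V' [[W oW WV'] V'x] V'V].
have GU : F (set_val @^-1` (set_val @` U)).
  by apply: filterS FU => u Uu; exists u.
have Wx : nbhs x W by apply: open_nbhs_nbhs; split => //; move: V'x; rewrite -WV'.
have [_ [[u Uu <-] Wu]] := xG _ _ GU Wx.
by exists u; split => //; apply: V'V; rewrite -WV'.
Qed.

(** Testing cardinality on finite subsets makes the condition visibly closed in
    the product topology. *)
Lemma subsets_leP (L : choiceType) n (chi : {ptws L -> bool}) :
  subsets_le L n chi <-> forall s : seq L, uniq s -> all chi s -> (size s <= n)%N.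
Proof.
rewrite /subsets_le /=; split=> [le s us /allP chis|le].
  have Afin : finite_set [set i | chi i = true] by apply/finite_set_leP; exists n.
  apply: leq_trans (geq_card_fset_set le); apply: uniq_leq_size => // i /chis ci.
  by rewrite in_fset_set// inE.
have sizes (B : seq L) : uniq B -> [set` B] `<=` [set i | chi i = true] ->
    (size B <= n)%N.
  by move=> uB Bchi; apply: le => //; apply/allP => i; exact: Bchi.
have Afin : finite_set [set i | chi i = true].
  apply: contrapT => /(infinite_set_fset n.+1)[B Bchi].
  by rewrite ltnNge sizes.
have [m Am] := (finite_setP _).1 Afin.
rewrite (card_le_eql Am) card_le_II -(card_fset_set Am); apply: sizes => //.
by rewrite fset_setK.
Qed.

Lemma subsets_le_seq (L : choiceType) (s : seq L) :
  subsets_le L (size s) (fun i => i \in s).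
Proof.
apply/subsets_leP => t ut /allP ts; exact: uniq_leq_size.
Qed.

Lemma subsets_le_compact (L : choiceType) n : compact (subsets_le L n).
Proof.
have cT : compact [set: {ptws L -> bool}].
  have := @tychonoff L (fun=> bool) _ (fun=> bool_compact).
  by congr (compact _); rewrite eqEsubset.
apply: (subclosed_compact _ cT) => //.
move=> chi cl; apply/subsets_leP => s us schi.
have : nbhs chi [set f : {ptws L -> bool} | all f s].
  elim: s schi {us} => [_|a s IH /= /andP[achi /IH sn]]; first exact: filterE.
  have an : nbhs chi [set f : {ptws L -> bool} | f a].
    have tn : nbhs (chi a) [set b : bool | b].
      by rewrite achi; apply: open_nbhs_nbhs; split => //; exact: discrete_open.
    exact: (@proj_continuous L (fun=> bool) a chi _ tn).
  by apply: filterS (filterI an sn) => f /= [fa fs]; rewrite fa.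
by move=> /cl[f [/subsets_leP fle fs]]; exact: fle.
Qed.

Section indicator_sum.
Context {R : realType} {F : normedModType R} (L : choiceType) (n : nat) (v : F).

(** Coincides with [v] times the number of [i] in [s] that belong to A, for A in
    the summand of index [n]. *)
Definition indicator_sum_fun (s : seq L) (z : KL L) : F :=
  if z is Some (existT k A) then
    if k == n then \sum_(i <- s) (if set_val A i then v else 0) else 0
  else 0.

Lemma indicator_sum_continuous s : continuous (indicator_sum_fun s).
Proof.
have evc k i : continuous
    (fun A : set_type (subsets_le L k) => if set_val A i then v else 0 : F).
  move=> A.
  apply: (@continuous_comp _ bool _
    (fun A : set_type (subsets_le L k) => set_val A i)
    (fun b : bool => if b then v else 0)); last first.
    move=> U /nbhs_singleton Ub.
    by apply: open_nbhs_nbhs; split => //; exact: discrete_open.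
  apply: (@continuous_comp _ _ _ set_val (fun f : {ptws L -> bool} => f i)).
    exact: initial_continuous.
  exact: (@proj_continuous L (fun=> bool) i).
pose summand k (A : set_type (subsets_le L k)) : F :=
  if k == n then \sum_(i <- s) (if set_val A i then v else 0) else 0.
have sc k : continuous (summand k).
  rewrite /summand; case: eqP => _; last exact: cst_continuous.
  elim: s {summand} => [|i s IH].
    rewrite (_ : (fun _ => _) = cst 0); first exact: cst_continuous.
    by apply/funext => A; rewrite big_nil.
  rewrite (_ : (fun _ => _) = (fun A : set_type (subsets_le L k) =>
      (if set_val A i then v else 0) +
      \sum_(l <- s) (if set_val A l then v else 0))).
    by move=> A; exact: (cvgD (evc k i A) (IH A)).
  by apply/funext => A; rewrite big_cons.
have sumc := sigT_continuous summand sc.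
case=> [p|] U.
  by case: p => k A; exact: (sumc (existT _ k A) U).
move=> /nbhs_singleton U0.
(* The function vanishes outside the summand of index [n], which is compact and
   closed: its complement is a neighbourhood of the point at infinity. *)
pose C := existT (fun k => set_type (subsets_le L k)) n @`
  [set: set_type (subsets_le L n)].
exists C; last first.
  move=> _ [[[k A] nC <-]|->//]; rewrite /preimage/=.
  case: eqP => // kn; exfalso; apply: nC.
  by move: A; rewrite kn => A; exists A.
split.
  apply: continuous_compact.
    by apply: continuous_subspaceT;
    exact: (@existT_continuous nat (fun k => set_type (subsets_le L k)) n).
  by apply: compact_set_type; exact: subsets_le_compact.
rewrite -openC; apply/sigT_openP => k.
have [->|kn] := eqVneq k n.
  rewrite (_ : _ @^-1` _ = set0); first exact: open0.
  by rewrite -subset0 => A /=; apply; exists A.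
rewrite (_ : _ @^-1` _ = setT); first exact: openT.
rewrite -subTset => A _ [B _ /(congr1 (@projT1 _ _))/= nk].
by rewrite nk eqxx in kn.
Qed.

Lemma indicator_sum_in s :
  indicator_sum_fun s \in continuous_pred (K := KL L) (V := F).
Proof. by apply/asboolP; exact: indicator_sum_continuous. Qed.

Definition indicator_sum s : cspace (KL L) F := CSpace (indicator_sum_in s).

(** The two sums differ by one indicator on each side, and the difference of two
    indicators takes only the values 0, 1 and -1. *)
Lemma indicator_sum_lipschitz u w a b :
  `|indicator_sum (u ++ a :: w) - indicator_sum (u ++ b :: w)| <= `|v|.
Proof.
have subE (f g : cspace (KL L) F) z : (f - g) z = f z - g z by [].
apply: cspace_norm_le => // -[[k A]|]; rewrite subE /= ?subrr ?normr0//.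
case: eqP => _; last by rewrite subrr normr0.
rewrite !big_cat /= !big_cons opprD addrACA subrr add0r opprD addrACA subrr addr0.
by do 2! case: ifP => _; rewrite ?subrr ?subr0 ?sub0r ?normrN ?normr0.
Qed.

(** At the point [s] of [L]^{<= n}, all terms of the first sum are equal to [v]
    and all terms of the second vanish. *)
Lemma indicator_sum_separated s t : size s = n -> uniq (s ++ t) ->
  `|v| *+ n <= `|indicator_sum s - indicator_sum t|.
Proof.
move=> sn; rewrite cat_uniq => /and3P[_ /hasPn st _].
have chi_s : subsets_le L n (fun i => i \in s) by rewrite -sn; exact: subsets_le_seq.
have subE (f g : cspace (KL L) F) z : (f - g) z = f z - g z by [].
pose A : set_type (subsets_le L n) := SigSub (mem_set chi_s).
have AE i : set_val A i = (i \in s) by [].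
pose p : KL L := Some (existT (fun k => set_type (subsets_le L k)) n A).
apply: le_trans (cspace_norm_ub (indicator_sum s - indicator_sum t) p).
rewrite subE /= eqxx (eq_big_seq (fun=> v)) => [|i si]; last by rewrite AE si.
rewrite [X in _ - X]big1_seq => [|i /andP[_ ti]]; last first.
  by rewrite AE (negbTE (st _ ti)).
by rewrite subr0 big_const_seq count_predT sn iter_addr_0 normrMn.
Qed.

End indicator_sum.

(** * Embeddings of C(K_L) into c_0 *)

(** Defeats both kinds of embedding: a control of [h] at the single scale [c]
    produces points at distance [c *+ n] whose images remain at a distance that
    does not depend on [n]. *)
Lemma close_images (R : realType) (F : normedModType R)
    (hF : is_scalar_field F) (L : choiceType)
    (hL : forall m, exists j : beth m -> L, injective j) (Gamma : Type)
    (h : cspace (KL L) F -> c0 Gamma F) (n : nat) (c d : R) :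
  0 <= c -> 0 < d ->
  (forall x y, mdist x y <= c -> mdist (h x) (h y) <= d) ->
  exists x y, c *+ n <= mdist x y /\ mdist (h x) (h y) <= d *+ 4.
Proof.
move=> c0 d0 hcd.
have [code codeI] := scalar_field_code hF.
have [e e1] := scalar_field_unit hF.
have ce : `|c *: e| = c by rewrite normrZ e1 mulr1 ger0_norm.
have [X [phi [_ phin /(_ Gamma)conc]]] := c0_concentration codeI hL n.
have [|x [y [xy _ hxy]]] :=
    conc (fun s => h (indicator_sum n (c *: e) s)) d [::] d0.
  move=> u v a b; apply: hcd; rewrite -[leRHS]ce; exact: indicator_sum_lipschitz.
exists (indicator_sum n (c *: e) (phi x)), (indicator_sum n (c *: e) (phi y)).
by split => //; rewrite -{1}ce; apply: indicator_sum_separated.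
Qed.

Section moduli_bounds.
Context {R : realType} {M1 M2 : metricType R} (f : M1 -> M2).
Local Open Scope ereal_scope.

Lemma expansion_modulus_ub t x y : (mdist x y <= t)%R ->
  (mdist (f x) (f y))%:E <= expansion_modulus f t.
Proof. by move=> xy; apply: ereal_sup_ubound; exists (x, y). Qed.

Lemma compression_modulus_lb t x y : (t <= mdist x y)%R ->
  compression_modulus f t <= (mdist (f x) (f y))%:E.
Proof. by move=> xy; apply: ereal_inf_lbound; exists (x, y). Qed.

End moduli_bounds.

Theorem corollary3p5 (R : realType) (F : normedModType R)
    (hF : is_scalar_field F) (L : Type) (hL : has_card_beth_omega L)
    (Gamma : Type) :
  ~ coarsely_embeds (cspace (KL L) F) (c0 Gamma F) /\
  ~ uniformly_embeds (cspace (KL L) F) (c0 Gamma F).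
Proof.
have jL m : exists j : beth m -> {classic L}, injective j.
  have /card_leP[j] := hL.1 m.
  exists (fun b => set_val (j (to_setT b))) => a b.
  rewrite set_valE => /val_inj /(inj (f := j)) ab.
  by have := congr1 val (ab (in_setT _) (in_setT _)).
have close := @close_images R F hF {classic L} jL Gamma.
split=> -[f].
- move=> [expf compf].
  have [d d0 fd] : exists2 d : R, 0 < d &
      forall x y, mdist x y <= 1 -> mdist (f x) (f y) <= d.
    have := expf 1 ltr01; case E : (expansion_modulus f 1) => [r| |] // _.
      exists (Num.max 1 r) => [|x y /(@expansion_modulus_ub _ _ _ f)].
        by rewrite lt_max ltr01.
      by rewrite E lee_fin le_max => ->; rewrite orbT.
    exists 1 => // x y /(@expansion_modulus_ub _ _ _ f).
    by rewrite E leeNy_eq.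
  have /cvgeyPgt/(_ (d *+ 4))[t [_ tcomp]] := compf.
  have [x [y [xy fxy]]] := close f (Num.truncn `|t|).+1 1 d ler01 d0 fd.
  have tn : t < (Num.truncn `|t|).+1%:R.
    by rewrite (le_lt_trans (ler_norm t))// truncnS_gt.
  have := tcomp _ tn; apply/negP; rewrite -leNgt.
  by apply: le_trans (compression_modulus_lb f xy) _; rewrite lee_fin.
- move=> [expf compf].
  (* The division by 5 leaves room for the factor 4 of [close_images]. *)
  have [d d0 dcomp] : exists2 d : R, 0 < d & ((d *+ 4)%:E < compression_modulus f 1)%E.
    have := compf 1 ltr01; case: (compression_modulus f 1) => [r| |] //.
      rewrite lte_fin => r0; exists (r / 5%:R); first by rewrite divr_gt0.
      by rewrite lte_fin -[ltLHS]mulr_natr mulrAC ltr_pdivrMr// ltr_pM2l// ltr_nat.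
    by exists 1; rewrite ?ltry.
  have dn : nbhs 0%E [set u | (u < d%:E)%E].
    by apply: open_nbhs_nbhs; split; [exact: open_ereal_lt_ereal|rewrite /= lte_fin].
  have [r /= r0 expr] := expf _ dn.
  have [n _ /(_ _ (leqnn n)) /= nr] := near_infty_natSinv_lt (PosNum r0).
  have n0 : (0 : R) < n.+1%:R^-1 by [].
  have [|x [y [xy fxy]]] := close f n.+1 n.+1%:R^-1 d (ltW n0) d0.
    move=> x y /(@expansion_modulus_ub _ _ _ f) /le_lt_trans xy.
    rewrite ltW// -lte_fin; apply: xy; apply: expr => //=.
    by rewrite sub0r normrN gtr0_norm.
  rewrite -[leLHS]mulr_natr mulVf ?pnatr_eq0// in xy.
  move: dcomp; apply/negP; rewrite -leNgt.
  by apply: le_trans (compression_modulus_lb f xy) _; rewrite lee_fin.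
Qed.
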